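(* Let $(E,\lambda)$ be a connectivity system and $k\in\mathbb{N}$. For every $k$-pseudoflower $\Phi$ of $(E,\lambda)$ there is a $\leq$-maximal $k$-pseudoflower $\Psi$ of $(E,\lambda)$ such that $\Phi\leq\Psi$.
   Context: $\mathbb{N}$ contains $0$; expressions such as $k-1$ are taken in $\mathbb{Z}$. A connectivity system is a (possibly infinite) set $E$ with a map $\lambda:2^E\to\mathbb{N}\cup\{\infty\}$ such that for all $A,B\subseteq E$: $\lambda(A)=\lambda(E\setminus A)$ (symmetry), $\lambda(A)+\lambda(B)\geq\lambda(A\cup B)+\lambda(A\cap B)$ (submodularity), and $\lambda$ is limit-closed: if $n\in\mathbb{N}$ and $(A_i)_{i\in I}$ is a (non-empty) chain with respect to inclusion of subsets of $E$ with $\lambda(A_i)\le n$ for all $i$, then $\lambda(\bigcup_{i}A_i)\leq n$. The value $\lambda(A)$ is called the order (or connectivity) of $A$. A cyclic order on a set $I$ is a total strict cyclic order (a ternary relation on distinct elements that is cyclic, antisymmetric, transitive and total); $]x,y[$ is the set of $z$ lying strictly between $x$ and $y$ when going from $x$ to $y$. An interval of $I$ is a subset $Y\subseteq I$ such that for all distinct $x,z\in Y$ at least one of $]x,z[$ and $]z,x[$ is contained in $Y$ (so $\emptyset$, $I$ and singletons are intervals). A $k$-pseudoflower is a partition $(P_i)_{i\in I}$ of $E$ (into non-empty classes, called petals) with a cyclically ordered index set $I$ such that the union of any interval of partition classes has order at most $k-1$. A concatenation of a $k$-pseudoflower $\Psi=(P_i)_{i\in I}$ is a $k$-pseudoflower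 $\Phi=(Q_i)_{i\in I'}$ such that for every $i\in I$ there is $f(i)\in I'$ with $P_i\subseteq Q_{f(i)}$, and such that for all intervals $I''$ of $I'$ the set $f^{-1}(I'')$ is an interval of $I$. In this case one writes $\Phi\leq\Psi$ and calls $\Psi$ an extension of $\Phi$. The relation $\leq$ is a pre-order. An element $\Psi$ of a pre-order is maximal if $\Psi\leq\Psi'$ implies $\Psi'\leq\Psi$. *)

(* Defs.v *)
From mathcomp Require Import all_boot all_order all_algebra.
From mathcomp Require Import classical_sets constructive_ereal.

Set Implicit Arguments.
Unset Strict Implicit.
Unset Printing Implicit Defensive.

Local Open Scope classical_set_scope.
Local Open Scope ereal_scope.

(* The codomain N + {oo} of lambda is the set of nonnegative elements of
   \bar int, so that bounds such as k - 1 below are taken in Z. *)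
Record connectivity_system (E : Type) := ConnectivitySystem {
  order_of :> set E -> \bar int;
  order_of_ge0 : forall A : set E, 0 <= order_of A;
  order_of_sym : forall A : set E, order_of A = order_of (~` A);
  order_of_submod : forall A B : set E,
    order_of (A `|` B) + order_of (A `&` B) <= order_of A + order_of B;
  order_of_limit_closed : forall (n : nat) (C : set (set E)),
    C !=set0 -> total_on C subset ->
    (forall A, C A -> order_of A <= (n%:Z)%:E) ->
    order_of (\bigcup_(A in C) A) <= (n%:Z)%:E
}.

(* [cyc x y z] means that y is met strictly between x and z when going from
   x to z. *)
Record is_cyclic_order (I : Type) (cyc : I -> I -> I -> Prop) : Prop :=
  IsCyclicOrder {
  cyc_distinct : forall x y z, cyc x y z -> [/\ x <> y, y <> z & x <> z];
  cyc_cyclic : forall x y z, cyc x y z -> cyc y z x;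
  cyc_antisym : forall x y z, cyc x y z -> ~ cyc z y x;
  cyc_trans : forall x y z t, cyc x y z -> cyc x z t -> cyc x y t;
  cyc_total : forall x y z, x <> y -> y <> z -> x <> z ->
    cyc x y z \/ cyc z y x
}.

Definition between (I : Type) (cyc : I -> I -> I -> Prop) (x y : I) : set I :=
  [set z | cyc x z y].

Definition is_interval (I : Type) (cyc : I -> I -> I -> Prop) (Y : set I) :
    Prop :=
  forall x z, Y x -> Y z -> x <> z ->
    between cyc x z `<=` Y \/ between cyc z x `<=` Y.

Record pseudoflower (E : Type) (lambda : connectivity_system E) (k : nat) :=
  Pseudoflower {
  index : Type;
  cyc : index -> index -> index -> Prop;
  cyc_order : is_cyclic_order cyc;
  petal : index -> set E;
  petal_partition : classical_sets.partition [set: index] petal [set: E];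
  petal_order : forall Y : set index, is_interval cyc Y ->
    lambda (\bigcup_(i in Y) petal i) <= (k%:Z - 1)%:E
}.

(* [concatenation Phi Psi] is Phi <= Psi, i.e. Phi is a concatenation of Psi. *)
Definition concatenation (E : Type) (lambda : connectivity_system E) (k : nat)
    (Phi Psi : pseudoflower lambda k) : Prop :=
  exists f : index Psi -> index Phi,
    (forall i, petal i `<=` petal (f i)) /\
    (forall Y : set (index Phi), is_interval (@cyc _ _ _ Phi) Y ->
       is_interval (@cyc _ _ _ Psi) (f @^-1` Y)).

(* Main.v *)
Require Import Defs.
From mathcomp Require Import all_boot all_order all_algebra.
From mathcomp Require Import boolp classical_sets filter constructive_ereal.

Set Implicit Arguments.
Unset Strict Implicit.
Unset Printing Implicit Defensive.

Local Open Scope classical_set_scope.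

(** By Zorn's lemma it suffices to bound chains of pseudoflowers from above.
    Everything is transported to the ground set E: a pseudoflower is the same
    as a cyclic order on the classes of an equivalence relation on E (a
    [circular_preorder]), and its unions of intervals of petals are the [arc]s,
    the saturated sets whose members are not separated by two nonmembers.  In
    these terms Phi <= Psi just says that every arc of Phi is an arc of Psi
    ([concatenationP]).

    A chain of circular preorders is bounded by its ultraproduct along an
    ultrafilter containing all the tails of the chain: the axioms pass to the
    ultraproduct, and so does every arc of a member, being an arc of all later
    members ([chain_limit]).  Taking an ultraproduct rather than a union of the
    cyclic orders avoids orienting the members coherently: concatenations may
    reverse the cyclic order.

    The remaining point is that the arcs of the limit L again have order at
    most k - 1.  Sets of order at most k - 1 are closed under complements and
    unions of chains, hence also under intersections of chains.  If A is an arc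
    of L, then the union of the classes of a member P of the chain that meet A
    is an arc of P ([hull_arc]).  When A is a closed segment [x, y] of L, these
    hulls form a chain with intersection A ([segment_limit]).  Finally, an arc S
    of L that misses a point t is linearly ordered by cutting the circle at t,
    and S is the union over x in S of the chain of its final parts from x on,
    each of which is the union over y of the chain of segments [x, y]
    ([arc_of_segments]).  Splitting the two ends of S in this way makes it
    irrelevant how the petals of the chain overlap the ends of S. *)

(** * Circular preorders and their arcs *)

(** [turn x y z] means that y lies strictly between x and z.  The equivalence
    is part of the data because [turn] does not determine it when there are
    fewer than three classes. *)
Record circular_preorder (E : Type) := CircularPreorder {
  alike : E -> E -> Prop;
  turn : E -> E -> E -> Prop;
  alike_refl : forall x, alike x x;
  alike_sym : forall x y, alike x y -> alike y x;
  alike_trans : forall x y z, alike x y -> alike y z -> alike x z;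
  turn_alike : forall x x' y z, alike x x' -> turn x y z -> turn x' y z;
  turn_unlike : forall x y z, turn x y z -> ~ alike x y;
  turn_rot : forall x y z, turn x y z -> turn y z x;
  turn_asym : forall x y z, turn x y z -> ~ turn z y x;
  turn_trans : forall x y z t, turn x y z -> turn x z t -> turn x y t;
  turn_total : forall x y z, ~ alike x y -> ~ alike y z -> ~ alike x z ->
    turn x y z \/ turn z y x
}.

Arguments alike_sym {E c x y}.
Arguments turn_rot {E c x y z}.

Definition saturated (E : Type) (P : circular_preorder E) (A : set E) :=
  forall x y, alike P x y -> A x -> A y.

(** In the second clause the points x, y, z, w occur in this cyclic order, so
    the pair y, w separates x from z. *)
Definition arc (E : Type) (P : circular_preorder E) : set (set E) :=
  [set A | saturated P A /\
    forall x y z w, A x -> A z -> turn P x y z -> turn P z w x -> A y \/ A w].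

Lemma turn_alike2 (E : Type) (P : circular_preorder E) x y y' z :
  alike P y y' -> turn P x y z -> turn P x y' z.
Proof.
by move=> yy' t; exact: turn_rot (turn_rot (turn_alike yy' (turn_rot t))).
Qed.

Lemma turn_alike3 (E : Type) (P : circular_preorder E) x y z z' :
  alike P z z' -> turn P x y z -> turn P x y z'.
Proof.
by move=> zz' t; exact: turn_rot (turn_alike zz' (turn_rot (turn_rot t))).
Qed.

Lemma turn_unlike2 (E : Type) (P : circular_preorder E) x y z :
  turn P x y z -> ~ alike P y z.
Proof. by move=> t; exact: turn_unlike (turn_rot t). Qed.

Lemma turn_unlike3 (E : Type) (P : circular_preorder E) x y z :
  turn P x y z -> ~ alike P x z.
Proof. by move=> t /alike_sym; exact: turn_unlike (turn_rot (turn_rot t)). Qed.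

Arguments turn_unlike {E c x y z}.
Arguments turn_unlike2 {E P x y z}.
Arguments turn_unlike3 {E P x y z}.

Lemma turn_trans_tail (E : Type) (P : circular_preorder E) x y z t :
  turn P x y z -> turn P x z t -> turn P y z t.
Proof.
move=> xyz xzt; apply/turn_rot/turn_rot.
exact: turn_trans (turn_rot xzt) (turn_rot (turn_rot xyz)).
Qed.

(** Separation is symmetric: x, z separate y, w when y, w separate x, z. *)
Lemma arcC (E : Type) (P : circular_preorder E) A : arc P A -> arc P (~` A).
Proof.
move=> [satA crA]; split=> [x y /alike_sym xy nAx Ay|x y z w nAx nAz xyz zwx].
  by apply: nAx; exact: satA xy Ay.
apply: contrapT => /not_orP[/contrapT Ay /contrapT Aw].
have xzw := turn_rot (turn_rot zwx).
have wxy := turn_rot (turn_rot (turn_trans xyz xzw)).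
by have [] := crA _ _ _ _ Ay Aw (turn_trans_tail xyz xzw) wxy.
Qed.

Lemma arc_class (E : Type) (P : circular_preorder E) x : arc P (alike P x).
Proof.
split=> [y z yz xy|y z w v xy xw yzw _]; first exact: alike_trans xy yz.
by case: (turn_unlike3 yzw); exact: alike_trans (alike_sym xy) xw.
Qed.

Lemma arc_open (E : Type) (P : circular_preorder E) x z :
  arc P [set y | turn P x y z].
Proof.
split=> [y y' yy' /= xyz|y w y' v /= xyz xy'z ywy' y'vy].
  exact: turn_alike2 yy' xyz.
(* If y comes before y', then w, lying between them, is between x and z. *)
wlog xyy' : y w y' v xyz xy'z ywy' y'vy / turn P x y y'.
  move=> wlg; have nyy' := turn_unlike3 ywy'.
  case: (turn_total (turn_unlike xyz) nyy' (turn_unlike xy'z)) => t.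
    exact: wlg t.
  by apply/or_comm; apply: (wlg y' v y w) => //; exact: turn_rot (turn_rot t).
left; apply: turn_trans xy'z; apply: turn_rot.
exact: turn_trans (turn_rot (turn_rot xyy')) (turn_rot (turn_rot ywy')).
Qed.

Definition refines (E : Type) (P Q : circular_preorder E) := arc P `<=` arc Q.

Lemma arc_alike (E : Type) (P Q : circular_preorder E) x y :
  refines P Q -> alike Q x y -> alike P x y.
Proof.
move=> PQ xy; have [sat _] := PQ _ (arc_class P x).
exact: sat xy (alike_refl P x).
Qed.

Definition hull (E : Type) (P : circular_preorder E) (A : set E) : set E :=
  [set y | exists2 x, A x & alike P x y].

(** If c, d separated two classes of P met by A and the classes of c, d missed
    A, then a, c, b, d would be in this order in P, with a, b in A.  Since A is
    an arc of L, the pair c, d does not separate a, b in L.  So two of the four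
    points that are not neighbours in L are neighbours in P, and an open arc of
    P that contains only these two of the four is not an arc of L. *)
Lemma hull_arc (E : Type) (P L : circular_preorder E) A :
  refines P L -> arc L A -> arc P (hull P A).
Proof.
move=> PL [_ crA]; split.
  move=> x y xy [z Az zx].
  by exists z => //; exact: alike_trans zx xy.
move=> p c q d [a Aa ap] [b Ab bq] pcq qdp; apply: contrapT => /not_orP[nc nd].
have A_hull : A `<=` hull P A by move=> x Ax; exists x => //; exact: alike_refl.
have {nc} nAc : ~ A c by move=> /A_hull.
have {nd} nAd : ~ A d by move=> /A_hull.
have acb := turn_alike3 (alike_sym bq) (turn_alike (alike_sym ap) pcq).
have bda := turn_alike3 (alike_sym ap) (turn_alike (alike_sym bq) qdp).
move: {p q pcq qdp ap bq} acb bda => acb bda.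
have unlikeL x y : ~ alike P x y -> ~ alike L x y.
  by move=> + xy; apply; exact: arc_alike xy.
(* Exchanging the roles of a, b and of c, d if needed, c lies between a and b
   in L; then so does d. *)
wlog acbL : a b c d Aa Ab nAc nAd acb bda / turn L a c b.
  move=> wlg; have [t|t] := turn_total (unlikeL _ _ (turn_unlike acb))
    (unlikeL _ _ (turn_unlike2 acb)) (unlikeL _ _ (turn_unlike3 acb)).
    exact: (wlg a b c d).
  have [u|u] := turn_total (unlikeL _ _ (turn_unlike bda))
    (unlikeL _ _ (turn_unlike2 bda)) (unlikeL _ _ (turn_unlike3 bda)).
    exact: (wlg b a d c).
  by have [] := crA _ _ _ _ Aa Ab u t.
have adbL : turn L a d b.
  have [u|//] := turn_total (unlikeL _ _ (turn_unlike bda))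
    (unlikeL _ _ (turn_unlike2 bda)) (unlikeL _ _ (turn_unlike3 bda)).
  by have [] := crA _ _ _ _ Aa Ab acbL u.
(* In L the order is a, c, d, b or a, d, c, b. *)
have acd : turn P a c d := turn_trans acb (turn_rot (turn_rot bda)).
have [t|t] := turn_total (unlikeL _ _ (turn_unlike acd))
    (unlikeL _ _ (turn_unlike2 acd)) (unlikeL _ _ (turn_unlike3 acd)).
  have [_ cr] := PL _ (arc_open P a d).
  have [] := cr c d b a _ _ (turn_trans_tail t adbL) (turn_rot (turn_rot acbL)).
  - exact: acd.
  - exact: turn_rot (turn_rot bda).
  - by move=> /turn_unlike2; apply; exact: alike_refl.
  - by move=> /turn_unlike; apply; exact: alike_refl.
have [_ cr] := PL _ (arc_open P c a).
have adc : turn L a d c := turn_rot (turn_rot t).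
have [] := cr d c b a _ _ (turn_trans_tail adc acbL) (turn_rot (turn_rot adbL)).
- exact: turn_rot acd.
- exact: turn_rot acb.
- by move=> /turn_unlike; apply; exact: alike_refl.
- by move=> /turn_unlike2; apply; exact: alike_refl.
Qed.

(** * Families closed under complements and unions of chains *)

Definition limit_closed (E : Type) (O : set (set E)) :=
  (forall A, O A -> O (~` A)) /\
  (forall F : set (set E), F !=set0 -> total_on F subset -> F `<=` O ->
     O (\bigcup_(A in F) A)).

Lemma limit_closed_bigcap (E : Type) (O F : set (set E)) :
  limit_closed O -> F !=set0 -> total_on F subset -> F `<=` O ->
  O (\bigcap_(A in F) A).
Proof.
move=> Olim [A0 FA0] totF FO; have [OC OU] := Olim.
rewrite -[\bigcap_(A in F) A]setCK setC_bigcap -(bigcup_image F (@setC E) id).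
apply: (OC); apply: OU.
- by exists (~` A0); exists A0.
- move=> _ _ [A FA <-] [B FB <-].
  by have [AB|BA] := totF _ _ FA FB; [right|left]; exact: subsetC.
- by move=> _ [A FA <-]; apply: OC; exact: FO.
Qed.

(** The closed segment from x to y; it is the whole class of x, not the whole
    circle, when x and y are alike. *)
Definition segment (E : Type) (L : circular_preorder E) (x y : E) : set E :=
  [set w | [\/ alike L x w, alike L y w | turn L x w y]].

Lemma segment_arc (E : Type) (L : circular_preorder E) x y :
  arc L (segment L x y).
Proof.
have [xy|nxy] := pselect (alike L x y).
  suff -> : segment L x y = alike L x by exact: arc_class.
  apply/seteqP; split=> w; last by constructor 1.
  case=> [//|yw|/turn_unlike3 //]; exact: alike_trans xy yw.
suff -> : segment L x y = ~` [set w | turn L y w x] by exact/arcC/arc_open.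
apply/seteqP; split=> w.
  case=> [xw|yw|xwy] /= ywx.
  - exact: turn_unlike2 ywx (alike_sym xw).
  - exact: turn_unlike ywx yw.
  - exact: turn_asym ywx xwy.
move=> /= nywx.
have [|nxw] := pselect (alike L x w); first by constructor 1.
have [|nyw] := pselect (alike L y w); first by constructor 2.
constructor 3.
by have [] := turn_total nxw (fun wy => nyw (alike_sym wy)) nxy.
Qed.

(** A point w outside the segment lies strictly between y and x, and once P
    separates w from both x and y, the P-class of w stays between y and x: an
    arc that contains w and a point between x and y contains x or y. *)
Lemma segment_limit (E : Type) (C : set (circular_preorder E))
    (L : circular_preorder E) (O : set (set E)) (x y : E) :
  C !=set0 -> total_on C (@refines E) -> (forall P, C P -> refines P L) ->
  (forall w, ~ alike L w x -> ~ alike L w y ->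
     exists P, [/\ C P, ~ alike P w x & ~ alike P w y]) ->
  limit_closed O -> (forall P, C P -> arc P `<=` O) -> O (segment L x y).
Proof.
move=> [P0 CP0] totC CL sep Olim CO.
pose F := [set hull P (segment L x y) | P in C].
suff -> : segment L x y = \bigcap_(A in F) A.
  apply: limit_closed_bigcap => //.
  - by exists (hull P0 (segment L x y)); exists P0.
  - move=> _ _ [P CP <-] [Q CQ <-].
    have mono P1 P2 : refines P1 P2 ->
        hull P2 (segment L x y) `<=` hull P1 (segment L x y).
      by move=> P12 w [v sv vw]; exists v => //; exact: arc_alike vw.
    by have [/mono|/mono] := totC _ _ CP CQ; [right|left].
  - move=> _ [P CP <-]; apply: (CO _ CP).
    exact: hull_arc (CL _ CP) (segment_arc L x y).
apply/seteqP; split=> w.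
  by move=> sw _ [P CP <-]; exists w => //; exact: alike_refl.
move=> Fw; apply: contrapT => nsw.
have nxw : ~ alike L x w by apply: contra_not nsw; constructor 1.
have nwx : ~ alike L w x by move=> /alike_sym.
have nwy : ~ alike L w y.
  by move=> /alike_sym; apply: contra_not nsw; constructor 2.
have [P [CP nPwx nPwy]] := sep _ nwx nwy.
have [v sv vw] := Fw _ (imageP _ CP).
have PL a b : alike L a b -> alike P a b by apply: arc_alike; exact: CL.
have xvy : turn L x v y.
  case: sv => // [/PL xv|/PL yv]; [case: nPwx|case: nPwy];
  exact: alike_sym (alike_trans _ vw).
have ywx : turn L y w x.
  have [xwy|//] := turn_total nxw nwy (turn_unlike3 xvy).
  by case: nsw; constructor 3.
have [_ cr] := CL _ CP _ (arc_class P w).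
have yxv := turn_rot (turn_rot xvy).
have vyw := turn_rot (turn_rot (turn_trans ywx yxv)).
by have [] := cr w x v y (alike_refl P w) (alike_sym vw)
  (turn_trans_tail ywx yxv) vyw.
Qed.

(** The segments contained in an arc are directed by inclusion but need not form
    a chain, so the union is taken in two stages, one for each end. *)
Lemma arc_of_segments (E : Type) (L : circular_preorder E) (O : set (set E)) :
  limit_closed O -> O set0 -> O setT -> (forall x y, O (segment L x y)) ->
  arc L `<=` O.
Proof.
move=> [_ OU] O0 OT Oseg S arcS; have [satS crS] := arcS.
have [[s0 Ss0]|/nonemptyPn ->//] := pselect (S !=set0).
have [[t nSt]|allS] := pselect (exists t, ~ S t); last first.
  suff -> : S = setT by [].
  apply/seteqP; split=> // x _.
  by apply: contrapT => nSx; apply: allS; exists x.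
(* The linear preorder on S obtained by cutting the circle at t. *)
pose le x y := alike L x y \/ turn L t x y.
have unlike_t x : S x -> ~ alike L t x.
  by move=> Sx tx; apply: nSt; exact: satS (alike_sym tx) Sx.
have le_total x y : S x -> S y -> le x y \/ le y x.
  move=> Sx Sy; have [xy|nxy] := pselect (alike L x y); first by left; left.
  have [txy|yxt] := turn_total (unlike_t x Sx) nxy (unlike_t y Sy).
    by left; right.
  by right; right; exact: turn_rot (turn_rot yxt).
have le_trans x y z : le x y -> le y z -> le x z.
  move=> [xy|txy] [yz|tyz].
  - by left; exact: alike_trans xy yz.
  - by right; exact: turn_alike2 (alike_sym xy) tyz.
  - by right; exact: turn_alike3 yz txy.
  - by right; exact: turn_trans txy tyz.
have segE x y : S x -> S y -> le x y ->
    segment L x y = [set w | [/\ S w, le x w & le w y]].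
  move=> Sx Sy lexy; apply/seteqP; split=> w.
    case=> [xw|yw|xwy].
    - split; [exact: satS xw Sx|by left|].
      by apply: le_trans lexy; left; exact: alike_sym.
    - split; [exact: satS yw Sy| |by left; exact: alike_sym].
      by apply: le_trans lexy _; left.
    have txy : turn L t x y by case: lexy => // /(turn_unlike3 xwy).
    have xyt := turn_rot txy.
    have yxw := turn_rot (turn_rot xwy).
    split.
    - by have [] := crS _ _ _ _ Sx Sy xwy (turn_rot xyt).
    - by right; exact: turn_rot (turn_rot (turn_trans xwy xyt)).
    - by right; exact: turn_rot (turn_trans (turn_rot xyt) yxw).
  case=> Sw [xw _|txw]; first by constructor 1.
  case=> [/alike_sym yw|twy]; first by constructor 2.
  by constructor 3; exact: turn_trans_tail txw twy.
have OS x : S x -> O [set w | S w /\ le x w].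
  move=> Sx; set T := [set w | _].
  have -> : T = \bigcup_(A in [set segment L x y | y in T]) A.
    apply/seteqP; split=> [w [Sw xw]|w [_ [y [Sy xy] <-]]].
      exists (segment L x w); first by exists w.
      by constructor 2; exact: alike_refl.
    by rewrite segE // => -[].
  apply: (OU).
  - exists (segment L x x); exists x => //; split=> //; left; exact: alike_refl.
  - move=> _ _ [y [Sy xy] <-] [z [Sz xz] <-]; rewrite !segE//.
    by have [yz|zy] := le_total _ _ Sy Sz; [left|right] => w [? ? wy];
       split=> //; apply: le_trans wy _.
  - by move=> _ [y _ <-].
have -> : S = \bigcup_(A in [set [set w | S w /\ le x w] | x in S]) A.
  apply/seteqP; split=> [w Sw|w [_ [y Sy <-] []]//].
  exists [set v | S v /\ le w v]; first by exists w.
  by split=> //; left; exact: alike_refl.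
apply: OU.
- by exists [set w | S w /\ le s0 w]; exists s0.
- move=> _ _ [y Sy <-] [z Sz <-].
  by have [yz|zy] := le_total _ _ Sy Sz; [right|left] => w [? wy]; split=> //;
     exact: le_trans wy.
- by move=> _ [y Sy <-]; exact: OS.
Qed.

(** * Ultraproducts of circular preorders *)

Lemma ultra_not (T : Type) (U : set_system T) (UU : UltraFilter U) (A : set T) :
  ~ U A -> U (~` A).
Proof. by have [] := in_ultra_setVsetC A UU. Qed.
Arguments ultra_not {T U UU A}.

(** Each axiom is a first-order sentence, so it holds in L as soon as it holds in
    every factor; totality is where U has to be an ultrafilter and not just a
    filter. *)
Lemma ultraproduct (E : Type) (U : set_system (circular_preorder E)) :
  UltraFilter U -> exists L : circular_preorder E,
    (forall x y, alike L x y = U [set P | alike P x y]) /\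
    (forall x y z, turn L x y z = U [set P | turn P x y z]).
Proof.
move=> UU.
unshelve refine (ex_intro _ (@CircularPreorder E
  (fun x y => U [set P | alike P x y]) (fun x y z => U [set P | turn P x y z])
  _ _ _ _ _ _ _ _ _) (conj (fun _ _ => erefl) (fun _ _ _ => erefl))).
- by move=> x; apply: filterS filterT => P _; exact: alike_refl.
- by move=> x y; apply: filterS => P; exact: alike_sym.
- by move=> x y z; apply: filterS2 => P; exact: alike_trans.
- by move=> x x' y z; apply: filterS2 => P; exact: turn_alike.
- move=> x y z t a; have [P [tP]] := filter_ex (filterI t a).
  exact: turn_unlike tP.
- by move=> x y z; apply: filterS => P; exact: turn_rot.
- move=> x y z t t'; have [P [tP]] := filter_ex (filterI t t').
  exact: turn_asym tP.
- by move=> x y z t; apply: filterS2 => P; exact: turn_trans.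
- move=> x y z /ultra_not nxy /ultra_not nyz /ultra_not nxz.
  have [|Un] := in_ultra_setVsetC [set P | turn P x y z] UU; first by left.
  right; apply: filterS (filterI (filterI Un nxy) (filterI nyz nxz)).
  by move=> P [[nt nPxy] [nPyz nPxz]]; have [] := turn_total nPxy nPyz nPxz.
Qed.

(** The second conclusion says that the classes of L are no finer than the chain
    forces.  It is about two points x, y because one and the same member has to
    separate w from both ends of a segment. *)
Lemma chain_limit (E : Type) (C : set (circular_preorder E)) :
  C !=set0 -> total_on C (@refines E) ->
  exists L : circular_preorder E, (forall P, C P -> refines P L) /\
    forall w x y, ~ alike L w x -> ~ alike L w y ->
      exists P, [/\ C P, ~ alike P w x & ~ alike P w y].
Proof.
move=> [P0 CP0] totC.
pose tail P := [set Q | C Q /\ refines P Q].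
have tailF : ProperFilter (filter_from C tail).
  apply: filter_from_proper => [|P CP]; last by exists P; split.
  apply: filter_from_filter => [|P Q CP CQ]; first by exists P0.
  have [PQ|QP] := totC _ _ CP CQ; [exists Q|exists P] => // R [CR ?]; split;
    split=> //; exact: subset_trans PQ _ || exact: subset_trans QP _.
have [U [UU tailU]] := ultraFilterLemma tailF.
have [L [alL tuL]] := ultraproduct UU.
have Utail P : C P -> U (tail P) by move=> CP; apply: tailU; exists P.
exists L; split=> [P CP A arcA|w x y].
  split=> [x y|x y z w Ax Az].
    rewrite alL => /(filterI (Utail P CP))/filter_ex [Q [[_ PQ] xy]].
    by have [sat _] := PQ _ arcA; exact: sat xy.
  rewrite !tuL => xyz zwx.
  have [Q [[_ PQ] [tQ tQ']]] :=
    filter_ex (filterI (Utail P CP) (filterI xyz zwx)).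
  by have [_ cr] := PQ _ arcA; exact: cr tQ tQ'.
rewrite !alL => /ultra_not nwx /ultra_not nwy.
have [P [[CP _] [? ?]]] :=
  filter_ex (filterI (Utail _ CP0) (filterI nwx nwy)).
by exists P.
Qed.

(** * Pseudoflowers as circular preorders *)

Lemma petal_cover (E : Type) (lambda : connectivity_system E) (k : nat)
    (Psi : pseudoflower lambda k) (x : E) :
  exists i : Defs.index Psi, petal i x.
Proof.
have [cov _ _] := petal_partition Psi.
have : [set: E] x by [].
by rewrite -cov => -[i _ ix]; exists i.
Qed.

Definition petal_of (E : Type) (lambda : connectivity_system E) (k : nat)
    (Psi : pseudoflower lambda k) (x : E) : Defs.index Psi :=
  sval (cid (petal_cover Psi x)).

Lemma petal_ofP (E : Type) (lambda : connectivity_system E) (k : nat)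
    (Psi : pseudoflower lambda k) (x : E) : petal (petal_of Psi x) x.
Proof. exact: svalP (cid (petal_cover Psi x)). Qed.

Lemma petal_ofE (E : Type) (lambda : connectivity_system E) (k : nat)
    (Psi : pseudoflower lambda k) (i : Defs.index Psi) (x : E) :
  petal i x <-> petal_of Psi x = i.
Proof.
split=> [ix|<-]; last exact: petal_ofP.
have [_ triv _] := petal_partition Psi.
by apply: triv => //; exists x; split=> //; exact: petal_ofP.
Qed.

Lemma petal_of_surj (E : Type) (lambda : connectivity_system E) (k : nat)
    (Psi : pseudoflower lambda k) (i : Defs.index Psi) :
  exists x, petal_of Psi x = i.
Proof.
have [_ _ ne] := petal_partition Psi.
by have [x /petal_ofE] := ne i I; exists x.
Qed.

Definition circular_of (E : Type) (lambda : connectivity_system E) (k : nat)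
    (Psi : pseudoflower lambda k) : circular_preorder E.
Proof.
apply: (@CircularPreorder E (fun x y => petal_of Psi x = petal_of Psi y)
  (fun x y z => cyc (petal_of Psi x) (petal_of Psi y) (petal_of Psi z))).
- by [].
- by move=> x y ->.
- by move=> x y z -> ->.
- by move=> x x' y z ->.
- by move=> x y z /(cyc_distinct (cyc_order Psi)) [].
- by move=> x y z; exact: (cyc_cyclic (cyc_order Psi)).
- by move=> x y z; exact: (cyc_antisym (cyc_order Psi)).
- by move=> x y z t; exact: (cyc_trans (cyc_order Psi)).
- by move=> x y z; exact: (cyc_total (cyc_order Psi)).
Defined.

Lemma interval_arc (E : Type) (lambda : connectivity_system E) (k : nat)
    (Psi : pseudoflower lambda k) (Y : set (Defs.index Psi)) :
  is_interval (@cyc _ _ _ Psi) Y <->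
  arc (circular_of Psi) (petal_of Psi @^-1` Y).
Proof.
split=> [intY|[_ cr] i j].
  split=> [x y /= ->//|x y z w /= Yx Yz xyz zwx].
  have [_ _ nxz] := cyc_distinct (cyc_order Psi) xyz.
  by have [sub|sub] := intY _ _ Yx Yz nxz; [left|right]; exact: sub.
have [x <-] := petal_of_surj i; have [z <-] := petal_of_surj j => Yx Yz nxz.
apply: contrapT => /not_orP[/existsNP[l /not_implyP[bl nYl]]
  /existsNP[m /not_implyP[bm nYm]]].
have [y yl] := petal_of_surj l; have [w wm] := petal_of_surj m; subst l m.
by have [] := cr _ _ _ _ Yx Yz bl bm.
Qed.

Lemma arcE (E : Type) (lambda : connectivity_system E) (k : nat)
    (Psi : pseudoflower lambda k) (A : set E) :
  arc (circular_of Psi) A -> A = petal_of Psi @^-1` (petal_of Psi @` A).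
Proof.
move=> [sat _]; apply/seteqP; split=> x; first by move=> Ax; exists x.
by move=> [y Ay yx]; exact: sat yx Ay.
Qed.

(** A map of petals as in the definition of a concatenation can only send the
    petal of Psi at x to the petal of Phi at x; conversely, this map is well
    defined when arcs of Phi are arcs of Psi, since single petals are arcs. *)
Lemma concatenationP (E : Type) (lambda : connectivity_system E) (k : nat)
    (Phi Psi : pseudoflower lambda k) :
  concatenation Phi Psi <-> refines (circular_of Phi) (circular_of Psi).
Proof.
split=> [[f [fsub fint]] A arcA|ref].
  have fE x : f (petal_of Psi x) = petal_of Phi x.
    by apply/esym/petal_ofE/fsub/petal_ofP.
  have AE := arcE arcA; rewrite AE in arcA *; set Y := _ @` A.
  have /fint/interval_arc := (interval_arc (_ @` A)).2 arcA.
  by congr arc; apply/seteqP; split=> x /=; rewrite fE.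
pose r (i : Defs.index Psi) := sval (cid (petal_of_surj i)).
have rK i : petal_of Psi (r i) = i := svalP (cid (petal_of_surj i)).
pose f i := petal_of Phi (r i).
have fE x : f (petal_of Psi x) = petal_of Phi x.
  by apply: (arc_alike ref); exact: rK.
exists f; split=> [i x /petal_ofE <-|Y /interval_arc/ref arcY].
  by apply/petal_ofE; rewrite fE.
by apply/interval_arc; congr arc: arcY; apply/seteqP; split=> x /=; rewrite fE.
Qed.

Lemma arc_order (E : Type) (lambda : connectivity_system E) (k : nat)
    (Psi : pseudoflower lambda k) (A : set E) :
  arc (circular_of Psi) A -> (lambda A <= (k%:Z - 1)%:E)%E.
Proof.
move=> arcA; have AE := arcE arcA.
have /petal_order : is_interval (@cyc _ _ _ Psi) (petal_of Psi @` A).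
  by apply/interval_arc; rewrite -AE.
congr (lambda _ <= _)%E; rewrite [RHS]AE; apply/seteqP; split=> x.
  by move=> [i Yi /petal_ofE xi] /=; rewrite xi.
by move=> Yx; exists (petal_of Psi x) => //; exact: petal_ofP.
Qed.

Lemma pseudoflower_of_circular (E : Type) (lambda : connectivity_system E)
    (k : nat) (L : circular_preorder E) :
  (forall A, arc L A -> (lambda A <= (k%:Z - 1)%:E)%E) ->
  exists Psi : pseudoflower lambda k, refines L (circular_of Psi).
Proof.
move=> ordL.
(* [E -> Prop] instead of [set E] keeps the universe of the index type
   unrelated to that of [set], hence small enough for Zorn's lemma to range over
   pseudoflowers. *)
pose I := {A : E -> Prop | exists x, A = alike L x}.
pose cl x : I := exist _ (alike L x) (ex_intro _ x erefl).
have clE x y : alike L x y -> cl x = cl y.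
  move=> xy; apply: eq_exist; apply/seteqP; split=> z.
    exact: alike_trans (alike_sym xy).
  exact: alike_trans xy.
have cl_surj (i : I) : exists x, cl x = i.
  by case: i => A Ax; have [x xA] := Ax; exists x; apply: eq_exist.
pose r i := sval (cid (cl_surj i)).
have rK i : cl (r i) = i := svalP (cid (cl_surj i)).
have cl_alike x y : cl x = cl y -> alike L x y.
  by move=> /(congr1 sval) /= ->; exact: alike_refl.
have r_cl x : alike L (r (cl x)) x by apply: cl_alike; exact: rK.
have r_neq i j : i <> j -> ~ alike L (r i) (r j).
  by move=> + /clE; rewrite !rK.
pose c (i j l : I) := turn L (r i) (r j) (r l).
have c_order : is_cyclic_order c.
  split.
  - move=> i j l t; split=> e; subst.
    + exact: turn_unlike t (alike_refl _ _).
    + exact: turn_unlike2 t (alike_refl _ _).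
    + exact: turn_unlike3 t (alike_refl _ _).
  - by move=> i j l; exact: turn_rot.
  - by move=> i j l; exact: turn_asym.
  - by move=> i j l m; exact: turn_trans.
  - by move=> i j l /r_neq ij /r_neq jl /r_neq il; exact: turn_total.
pose pet (i : I) : set E := alike L (r i).
have petP i x : pet i x <-> cl x = i.
  by split=> [/clE <-|<-]; [rewrite rK|exact: r_cl].
have part : classical_sets.partition [set: I] pet [set: E].
  split.
  - by apply/seteqP; split=> // x _; exists (cl x) => //; apply/petP.
  - by move=> i j _ _ [x [/petP <- /petP]].
  - by move=> i _; exists (r i); exact: alike_refl.
have turn_c x y z : turn L x y z <-> c (cl x) (cl y) (cl z).
  split=> t.
    apply: turn_alike (alike_sym (r_cl x)) _.
    apply: turn_alike2 (alike_sym (r_cl y)) _.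
    exact: turn_alike3 (alike_sym (r_cl z)) t.
  apply: turn_alike (r_cl x) _.
  apply: turn_alike2 (r_cl y) _.
  exact: turn_alike3 (r_cl z) t.
have ord Y : is_interval c Y ->
    (lambda (\bigcup_(i in Y) pet i) <= (k%:Z - 1)%:E)%E.
  move=> intY; apply: ordL.
  have -> : \bigcup_(i in Y) pet i = cl @^-1` Y.
    apply/seteqP; split=> x; first by move=> [i Yi /petP xi] /=; rewrite xi.
    by move=> Yx; exists (cl x) => //; apply/petP.
  split=> [x y /clE /= -> //|x y z w /= Yx Yz /turn_c t /turn_c t'].
  have [_ _ nxz] := cyc_distinct c_order t.
  by have [sub|sub] := intY _ _ Yx Yz nxz; [left|right]; exact: sub.
exists (Pseudoflower c_order part ord); set Psi := Pseudoflower _ _ _.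
have petal_of_cl x : petal_of Psi x = cl x by apply/petal_ofE; apply/petP.
move=> A [sat cr]; split=> [x y|x y z w Ax Az].
  by rewrite /= !petal_of_cl => /cl_alike; exact: sat.
rewrite /= !petal_of_cl => /(turn_c _ _ _).2 t /(turn_c _ _ _).2.
exact: cr t.
Qed.

Lemma order_limit_closed (E : Type) (lambda : connectivity_system E) (k : nat) :
  limit_closed [set A | (lambda A <= (k%:Z - 1)%:E)%E].
Proof.
split=> [A /=|F [A0 FA0] totF FO]; first by rewrite -order_of_sym.
(* For k = 0 the bound k - 1 is negative, and the family is empty. *)
case: k FO => [|n] FO.
  by have := Order.POrderTheory.le_trans (order_of_ge0 lambda A0) (FO _ FA0).
have E1 : (n.+1%:Z - 1 = n%:Z)%R.
  by rewrite intS GRing.addrAC GRing.subrr GRing.add0r.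
rewrite /= E1; apply: order_of_limit_closed => //; first by exists A0.
by move=> A /FO /=; rewrite E1.
Qed.

Theorem corollary5p2 (E : Type) (lambda : connectivity_system E) (k : nat)
    (Phi : pseudoflower lambda k) :
  exists Psi : pseudoflower lambda k,
    premaximal (@concatenation E lambda k) Psi /\ concatenation Phi Psi.
Proof.
have crefl (P : pseudoflower lambda k) : concatenation P P.
  exact/concatenationP.
have ctrans (P Q R : pseudoflower lambda k) :
    concatenation P Q -> concatenation Q R -> concatenation P R.
  move=> /concatenationP PQ /concatenationP QR; apply/concatenationP.
  exact: subset_trans PQ QR.
pose T := {Psi : pseudoflower lambda k | concatenation Phi Psi}.
pose t0 : T := exist _ Phi (crefl Phi).
have [||A totA|[Psi PhiPsi] maxPsi] :=
  @ZL_preorder T t0 (fun s t => `[< concatenation (sval s) (sval t) >]).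
- by move=> t; apply/asboolP; exact: crefl.
- by move=> r s t /asboolP rs /asboolP st; apply/asboolP; exact: ctrans st.
(* The empty chain is bounded by Phi itself. *)
- have [[s0 As0]|/nonemptyPn A0] := pselect (A !=set0); last first.
    by exists t0 => s; rewrite A0.
  pose C := [set circular_of (sval s) | s in A].
  have C0 : C !=set0 by exists (circular_of (sval s0)); exists s0.
  have totC : total_on C (@refines E).
    move=> _ _ [s As <-] [t At <-].
    by have [/asboolP/concatenationP|/asboolP/concatenationP] := totA _ _ As At;
      [left|right].
  have [L [CL sep]] := chain_limit C0 totC.
  have [|Psi LPsi] := @pseudoflower_of_circular E lambda k L.
    have CO P B : C P -> arc P B -> (lambda B <= (k%:Z - 1)%:E)%E.
      by move=> [s As <-]; exact: arc_order.
    have Cs0 : C (circular_of (sval s0)) by exists s0.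
    have Olim := order_limit_closed lambda k.
    apply: (arc_of_segments Olim) => [||x y].
    - by apply: CO Cs0 _; split.
    - by apply: CO Cs0 _; split=> // *; left.
    - apply: (segment_limit C0 totC CL _ Olim) => [w|P CP B]; first exact: sep.
      exact: CO.
  have sPsi s : A s -> concatenation (sval s) Psi.
    move=> As; apply/concatenationP; apply: subset_trans LPsi; apply: CL.
    by exists s.
  exists (exist _ Psi (ctrans _ _ _ (svalP s0) (sPsi _ As0))) => s As.
  by apply/asboolP; exact: sPsi.
exists Psi; split=> // Psi' PsiPsi'.
apply/asboolP/(maxPsi (exist _ Psi' (ctrans _ _ _ PhiPsi PsiPsi'))).
exact/asboolP.
Qed.
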